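(* Consider the Facility location game with $C:=1$ and $D:=1$. Let $A$ be a deterministic algorithm for Learner and let $B:[0,\infty)^3\to[0,\infty)$ be a function that is monotonic increasing (non-decreasing) in its first variable and such that for every $\epsilon>0$ there exist $N,T\in\mathbb{N}$ with $B(2/\sqrt{N},N,T)<\epsilon$. Then for every $\epsilon>0$ there exist $N,T\in\mathbb{N}$, a sequence of Nature's selections of cost vectors $c^t,d^t\in[0,1]^N$ ($t=1,\dots,T$) and a non-empty set $X^*\subseteq\{1,\dots,N\}$ such that $$B\left(\frac1T\sum_{t=1}^T\ell_{c^t,d^t}(X^* ),\,N,\,T\right)<\epsilon\qquad\text{and}\qquad\frac1T\sum_{t=1}^T\ell_{c^t,d^t}(X^t)\ge1,$$ where $X^t$ is the selection of $A$ on trial $t$. In addition, the opening cost vectors can be taken not to vary from trial to trial, i.e. there is $c\in[0,1]^N$ with $c^t=c$ for all $t\in\{1,\dots,T\}$.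
   Context: $\mathbb{N}$ is the set of positive integers. For $c\in[0,C]^N$, $d\in[0,D]^N$ and non-empty $X\subseteq\{1,\dots,N\}$, $\ell_{c,d}(X)=\sum_{i\in X}c_i+\min_{i\in X}d_i$. The Facility location game with $N$ sites and $T$ trials: on trial $t=1,\dots,T$, (1) Nature selects $c^t\in[0,C]^N$ and $d^t\in[0,D]^N$ without revealing them; (2) Learner chooses a non-empty set $X^t\subseteq\{1,\dots,N\}$; (3) $c^t,d^t$ are revealed; (4) Learner incurs loss $\ell_{c^t,d^t}(X^t)$. A deterministic algorithm for Learner specifies, for all $N$ and $T$ and all $t\le T$, the set $X^t$ as a function of $(c^s,d^s)_{s<t}$. *)

(* Defs.v *)
From HB Require Import structures.
From mathcomp Require Import all_boot all_order all_algebra.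
From mathcomp Require Import reals.

Set Implicit Arguments.
Unset Strict Implicit.
Unset Printing Implicit Defensive.

Import Order.TTheory GRing.Theory Num.Theory.

Local Open Scope ring_scope.

Notation costs R N := {ffun 'I_N -> R}.

Definition in_box (R : realType) (M : R) (N : nat) (c : costs R N) : Prop :=
  forall i : 'I_N, 0 <= c i <= M.

(* The value on the empty set is a dummy: only non-empty sets may be played. *)
Definition min_over (R : realType) (N : nat) (d : costs R N)
    (X : {set 'I_N}) : R :=
  if [pick i in X] is Some i0 then d [arg min_(i < i0 in X) d i]%O else 0.

Definition loss (R : realType) (N : nat) (c d : costs R N)
    (X : {set 'I_N}) : R :=
  \sum_(i in X) c i + min_over d X.

(* On trial t (counting from 0) of the game with N sites and T trials, Learner
   plays [select N T h], where h lists the t pairs (c^s, d^s), s < t; the trial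
   number is thus [size h]. The function is total, but it is only required to
   return a legal (non-empty) set on the histories that can occur. *)
Record algorithm (R : realType) (C D : R) := Algorithm {
  select :> forall N : nat, nat -> seq (costs R N * costs R N) -> {set 'I_N};
  select_neq0 : forall (N T : nat) (h : seq (costs R N * costs R N)),
    (0 < N)%N -> (size h < T)%N ->
    {in h, forall cd, in_box C cd.1 /\ in_box D cd.2} ->
    select T h != set0
}.

Definition history (R : realType) (N T : nat) (c d : 'I_T -> costs R N)
    (t : 'I_T) : seq (costs R N * costs R N) :=
  [seq (c s, d s) | s : 'I_T <- enum 'I_T & (s < t)%N].

Definition selection (R : realType) (C D : R) (A : algorithm C D) (N T : nat)
    (c d : 'I_T -> costs R N) (t : 'I_T) : {set 'I_N} :=
  A N T (history c d t).

(* Main.v *)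
(* Nature fixes every opening cost to 1/sqrt N. If Learner opens at least sqrt N
   sites, the opening cost alone is 1; otherwise Nature puts connection cost 1 on
   the opened sites and 0 elsewhere, so Learner still pays 1, while the connection
   costs of the trial sum to at most sqrt N. By averaging, some single site has
   mean connection cost at most 1/sqrt N, hence mean loss at most 2/sqrt N. *)

Require Import Defs.
From HB Require Import structures.
From mathcomp Require Import all_boot all_order all_algebra.
From mathcomp Require Import reals.

Set Implicit Arguments.
Unset Strict Implicit.
Unset Printing Implicit Defensive.

Import Order.TTheory GRing.Theory Num.Theory.

Local Open Scope ring_scope.

Lemma min_over1 (R : realType) (N : nat) (d : costs R N) (i : 'I_N) :
  min_over d [set i] = d i.
Proof.
rewrite /min_over; case: pickP => [j ji|/(_ i)]; last by rewrite set11.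
by case: arg_minP => // k /set1P ->.
Qed.

Lemma min_over_ge (R : realType) (N : nat) (d : costs R N) (X : {set 'I_N})
    (m : R) :
  X != set0 -> {in X, forall i, m <= d i} -> m <= min_over d X.
Proof.
move=> /set0Pn[i Xi] md; rewrite /min_over.
case: pickP => [j Xj|/(_ i)]; last by rewrite Xi.
by case: arg_minP => // k Xk _; exact: md.
Qed.

Lemma exists_le_average (R : realType) (N : nat) (f : 'I_N -> R) (m : R) :
  (0 < N)%N -> \sum_i f i <= m *+ N -> exists i, f i <= m.
Proof.
move=> N0 fm; apply/existsP; apply: contraLR fm => /existsPn mf.
rewrite -ltNge -[X in _ *+ X]card_ord -sumr_const.
apply: ltr_sum => [|i _]; last by rewrite ltNge.
(* A sum of strict inequalities is strict only over a non-empty index set; [N0] supplies an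
   index. *)
by apply/hasP; exists (Ordinal N0); rewrite ?mem_index_enum.
Qed.

Section Adversary.
Variables (R : realType) (N : nat).
Implicit Types (X : {set 'I_N}) (h : seq (costs R N * costs R N)).

Definition opening_cost : costs R N := [ffun=> (Num.sqrt N%:R)^-1].

(** The costs vanish altogether once [X] has at least [sqrt N] sites: the opening cost then
    suffices, and the total over all sites never exceeds [sqrt N]. *)
Definition adversary X : costs R N :=
  [ffun i => ((i \in X) && (#|X|%:R < Num.sqrt N%:R :> R))%:R].

Lemma opening_cost_in_box : in_box 1 opening_cost.
Proof.
move=> i; rewrite ffunE invr_ge0 sqrtr_ge0 /=.
have N1 : 1 <= N%:R :> R by rewrite ler1n (leq_ltn_trans _ (ltn_ord i)).
by rewrite invf_le1 ?sqrtr_gt0 ?(lt_le_trans ltr01)// -{1}sqrtr1 ler_wsqrtr.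
Qed.

Lemma adversary_in_box X : in_box 1 (adversary X).
Proof. by move=> i; rewrite ffunE ler0n lern1 leq_b1. Qed.

Lemma loss_adversary_ge1 X : X != set0 -> 1 <= loss opening_cost (adversary X) X.
Proof.
move=> X0; rewrite /loss; under eq_bigr do rewrite ffunE.
rewrite sumr_const -[_ *+ _]mulr_natl.
have [i Xi] := set0Pn _ X0.
have s0 : 0 < Num.sqrt N%:R :> R.
  by rewrite sqrtr_gt0 ltr0n (leq_ltn_trans _ (ltn_ord i)).
have [small|large] := ltP (#|X|%:R : R) (Num.sqrt N%:R).
  rewrite -[leLHS]add0r; apply: lerD; first by rewrite divr_ge0 ?sqrtr_ge0.
  by apply: min_over_ge => // j Xj; rewrite ffunE Xj small.
rewrite -[leLHS]addr0; apply: lerD; first by rewrite ler_pdivlMr ?mul1r.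
by apply: min_over_ge => // j _; rewrite ffunE ler0n.
Qed.

Lemma sum_adversary_le X : \sum_i adversary X i <= Num.sqrt N%:R.
Proof.
under eq_bigr do rewrite ffunE.
have [small|large] := ltP (#|X|%:R : R) (Num.sqrt N%:R); last first.
  by rewrite big1 ?sqrtr_ge0// => i _; rewrite andbF.
under eq_bigr do rewrite andbT.
by rewrite -natr_sum -big_mkcond sum1_card ltW.
Qed.

(** Learner being deterministic, Nature can simulate the strategy [L] and fix all costs in advance;
    this is the transcript of the first [n] trials so obtained. *)
Fixpoint play (L : seq (costs R N * costs R N) -> {set 'I_N}) (n : nat) :=
  if n is m.+1 then
    rcons (play L m) (opening_cost, adversary (L (play L m)))
  else [::].

Lemma playE L n :
  play L n = [seq (opening_cost, adversary (L (play L k))) | k <- iota 0 n].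
Proof. by elim: n => // n IH; rewrite -addn1 iotaD map_cat -IH addn1 cats1. Qed.

Lemma size_play L n : size (play L n) = n.
Proof. by rewrite playE size_map size_iota. Qed.

Lemma play_in_box L n :
  {in play L n, forall cd, in_box 1 cd.1 /\ in_box 1 cd.2}.
Proof.
move=> cd; rewrite playE => /mapP[k _ ->].
by split; [exact: opening_cost_in_box|exact: adversary_in_box].
Qed.

(** Consistency of the simulation: when the precomputed costs are actually played, Learner sees the
    very transcript against which Nature computed its answer. *)
Lemma history_play L T (t : 'I_T) :
  history (fun=> opening_cost) (fun s => adversary (L (play L s))) t = play L t.
Proof.
rewrite playE /history.
have -> : iota 0 t = [seq val s | s : 'I_T <- enum 'I_T & (s < t)%N].
  rewrite -(filter_map val (fun k => k < t)%N) val_enum_ord.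
  (* Split the trials at [t]: the filter keeps all of the first block and nothing of the second. *)
  rewrite -[in iota 0 T](subnKC (ltnW (ltn_ord t))) iotaD filter_cat add0n.
  rewrite (@eq_in_filter _ _ predT) ?filter_predT; last first.
    by move=> k; rewrite mem_iota.
  rewrite (@eq_in_filter _ _ pred0) ?filter_pred0 ?cats0// => k.
  by rewrite mem_iota => /andP[tk _]; rewrite /= ltnNge tk.
by rewrite -map_comp.
Qed.

End Adversary.

Theorem theoremG1 (R : realType) (A : algorithm (1 : R) (1 : R))
    (B : R -> R -> R -> R)
    (B_ge0 : forall x y z : R, 0 <= x -> 0 <= y -> 0 <= z -> 0 <= B x y z)
    (B_mono : forall x x' y z : R, 0 <= x -> 0 <= y -> 0 <= z -> x <= x' ->
       B x y z <= B x' y z)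
    (B_small : forall e : R, 0 < e -> exists N T : nat,
       [/\ (0 < N)%N, (0 < T)%N & B (2 / Num.sqrt N%:R) N%:R T%:R < e]) :
  forall e : R, 0 < e ->
  exists (N T : nat) (c d : 'I_T -> costs R N) (Xs : {set 'I_N}),
    [/\ (0 < N)%N /\ (0 < T)%N,
        forall t : 'I_T, in_box 1 (c t) /\ in_box 1 (d t),
        Xs != set0,
        B ((\sum_(t < T) loss (c t) (d t) Xs) / T%:R) N%:R T%:R < e
          /\ 1 <= (\sum_(t < T) loss (c t) (d t) (selection A c d t)) / T%:R &
        exists c0 : costs R N, forall t : 'I_T, c t = c0].
Proof.
move=> e e0; have [N [T [N0 T0 Be]]] := B_small e e0.
pose L := A N T; pose s : R := Num.sqrt N%:R.
pose d (t : 'I_T) := adversary R (L (play L t)).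
have TR0 : 0 < T%:R :> R by rewrite ltr0n.
have s0 : 0 < s by rewrite sqrtr_gt0 ltr0n.
have ss : s * s = N%:R by rewrite -expr2 sqr_sqrtr.
(* Averaging over sites is applied to costs already summed over trials, so one site serves all
   trials. The grand total is at most [T * s], which is [N] times [T / s] because [N = s * s]. *)
have [i di] : exists i, \sum_(t < T) d t i <= T%:R / s.
  apply: exists_le_average N0 _; rewrite exchange_big /=.
  apply: (@le_trans _ _ (\sum_(t < T) s)).
    by apply: ler_sum => t _; exact: sum_adversary_le.
  by rewrite sumr_const card_ord -[leLHS]mulr_natl -[leRHS]mulr_natr -ss mulrA divfK ?gt_eqF.
have box t : in_box 1 (opening_cost R N) /\ in_box 1 (d t).
  by split; [exact: opening_cost_in_box|exact: adversary_in_box].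
exists N, T, (fun=> opening_cost R N), d, [set i]; split => //.
- by apply/set0Pn; exists i; rewrite set11.
- have lossE t : loss (opening_cost R N) (d t) [set i] = s^-1 + d t i.
    by rewrite /loss big_set1 min_over1 ffunE.
  split.
    under eq_bigr do rewrite lossE.
    (* It remains to bound the mean loss of [[set i]] by [2 / s], after checking that this mean is
       non-negative, as [B_mono] requires. *)
    apply: le_lt_trans Be; apply: B_mono => //.
      rewrite divr_ge0// sumr_ge0// => t _.
      by rewrite addr_ge0 ?invr_ge0 ?sqrtr_ge0 // ffunE ler0n.
    (* One [s^-1] is the opening cost of site [i]; the other comes from [di]. *)
    rewrite ler_pdivrMr// big_split /= sumr_const card_ord -[s^-1 *+ T]mulr_natr.
    by rewrite mulrAC -mulrA (mulr_natl _ 2) mulr2n [s^-1 * _]mulrC lerD2l.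
  rewrite ler_pdivlMr// mul1r -[X in X%:R](card_ord T) -sumr_const.
  apply: ler_sum => t _; rewrite /selection history_play.
  (* Learner's set is known to be non-empty because the transcript is legal: it has length [t < T]
     and all its costs lie in the box. *)
  apply/loss_adversary_ge1/select_neq0 => //; first by rewrite size_play.
  exact: play_in_box.
- by exists (opening_cost R N).
Qed.
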